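(* Let $\mathcal X=\{1,\ldots,n\}$, let $N>1$ be an integer, and let $M=[m_{ij}]$ be an $n\times n$ matrix with nonnegative entries such that all entries of $M^N$ are positive. Let $\lambda_M$ be the spectral radius of $M$, $\phi,\hat\phi$ right and left eigenvectors of $M$ for $\lambda_M$ with positive entries normalized so that $\sum_x\phi(x)\hat\phi(x)=1$, $\bar\nu(x)=\phi(x)\hat\phi(x)$ and $\bar\Pi=\lambda_M^{-1}\operatorname{diag}(\phi)^{-1}M\operatorname{diag}(\phi)$. Let $\mu_0$ be a measure on $\mathcal X$ with $\mu_0(x)>0$ for all $x$, and let $\mathfrak M(2N)$ be the measure on $\mathcal X^{2N+1}$ given by $\mathfrak M(2N)(x_0,\ldots,x_{2N})=\mu_0(x_0)\prod_{t=0}^{2N-1}m_{x_tx_{t+1}}$. Let $\nu$ be a probability measure on $\mathcal X$ and let $\mathfrak M^*[\nu,\nu](2N)$ be the Schrödinger bridge, i.e. the minimizer of $\mathbb D(P\|\mathfrak M(2N))$ over probability distributions $P$ on $\mathcal X^{2N+1}$ whose marginals at times $0$ and $2N$ both equal $\nu$. Suppose that the (Markovian) transition matrix $\Pi_\nu$ of $\mathfrak M^*[\nu,\nu](2N)$ does not depend on time. Then $\nu=\bar\nu$ and $\Pi_\nu=\bar\Pi$.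
   Context: Relative entropy of a probability distribution $P$ with respect to a nonnegative measure $Q$ on a finite set: $\mathbb D(P\|Q)=\sum_x P(x)\log\frac{P(x)}{Q(x)}$ if $\mathrm{supp}(P)\subseteq\mathrm{supp}(Q)$ (with $0\log0=0$), and $+\infty$ otherwise. The Schrödinger bridge exists, is unique, and is a (possibly time-inhomogeneous) Markov measure. *)

(* Defs.v *)
From HB Require Import structures.
From mathcomp Require Import all_boot all_order all_algebra.
From mathcomp Require Import all_classical all_reals all_analysis.
From mathcomp Require Import complex.
Set Implicit Arguments.
Unset Strict Implicit.
Unset Printing Implicit Defensive.
Import Order.TTheory GRing.Theory Num.Theory.
Local Open Scope ring_scope.

Definition path_space (n T : nat) := {ffun 'I_T.+1 -> 'I_n}.

Definition is_spectral_radius (R : realType) (n : nat) (M : 'M[R]_n) (r : R) :=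
  let MC := map_mx (fun x : R => real_complex R x) M in
  (exists z : R[i], eigenvalue MC z /\ `|z| = (r : R)%:C%C) /\
  (forall z : R[i], eigenvalue MC z -> `|z| <= (r : R)%:C%C).

Definition is_prob (R : realType) (T : finType) (P : T -> R) :=
  (forall x, 0 <= P x) /\ \sum_x P x = 1.

(* Relative entropy D(P || Q), with 0 log 0 = 0 and +oo when supp P is not
   contained in supp Q. *)
Definition rel_entropy (R : realType) (T : finType) (P Q : T -> R) : \bar R :=
  if [forall x, (P x != 0) ==> (Q x != 0)]
  then (\sum_(x | P x != 0) P x * ln (P x / Q x))%:E
  else +oo%E.

Definition marginal (R : realType) (n T : nat) (P : path_space n T -> R)
  (t : 'I_T.+1) (x : 'I_n) : R :=
  \sum_(w : path_space n T | w t == x) P w.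

Definition ref_measure (R : realType) (n T : nat) (mu0 : 'I_n -> R)
  (M : 'M[R]_n) (w : path_space n T) : R :=
  mu0 (w ord0) * \prod_(t < T) M (w (inord t)) (w (inord t.+1)).

Definition is_schroedinger_bridge (R : realType) (n T : nat)
  (Q : path_space n T -> R) (nu0 nuT : 'I_n -> R) (P : path_space n T -> R) :=
  [/\ is_prob P,
      marginal P ord0 =1 nu0,
      marginal P ord_max =1 nuT &
      forall P' : path_space n T -> R, is_prob P' ->
        marginal P' ord0 =1 nu0 -> marginal P' ord_max =1 nuT ->
        (rel_entropy P Q <= rel_entropy P' Q)%E].

Definition stochastic (R : realType) (n : nat) (Pi : 'M[R]_n) :=
  (forall x y, 0 <= Pi x y) /\ (forall x, \sum_y Pi x y = 1).

Definition homogeneous_markov (R : realType) (n T : nat)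
  (nu0 : 'I_n -> R) (Pi : 'M[R]_n) (P : path_space n T -> R) :=
  forall w : path_space n T,
    P w = nu0 (w ord0) * \prod_(t < T) Pi (w (inord t)) (w (inord t.+1)).

(* Main.v *)
Require Import Defs.
From HB Require Import structures.
From mathcomp Require Import all_boot all_order all_algebra.
From mathcomp Require Import all_classical all_reals all_analysis.
From mathcomp Require Import complex.
From mathcomp Require Import ring lra zify.
Import Order.TTheory GRing.Theory Num.Theory.
Local Open Scope ring_scope.

(** Moving mass [e] from two paths to the two paths obtained by exchanging
    their final points preserves both end marginals, so minimality forces
    [P w1 P w2 Q w3 Q w4 = P w3 P w4 Q w1 Q w2] whenever the end points of
    [w1, w2] and [w3, w4] are exchanged. Hence [P] charges every path that [Q]
    charges between points of the support of [nu]; passing through an arbitrary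
    point at time [N] and using homogeneity, [nu] is everywhere positive.
    Moreover the product of the ratios [Pi / M] along a path of length [2N] is
    a function of its initial point times a function of its final point.
    Comparing the first [2N] steps of a path of length [2N + 1] with its last
    [2N] steps yields [Pi x y = k M x y h y / h x]. As [Pi] is stochastic, [h] is a
    positive eigenvector of [M], hence proportional to [phi], and [nu / phi] is a
    positive left eigenvector of [M ^+ (2N)], hence proportional to [phihat]. *)

(** * Walks and positivity of matrix powers *)

(** Sequences are indexed by all of [nat], with values past [T] irrelevant, so that shifting and
    joining walks needs no ordinal casts. *)
Definition walk {n} (e : rel 'I_n) (T : nat) (x y : 'I_n) (u : nat -> 'I_n) :=
  [/\ u 0%N = x, u T = y & forall t, (t < T)%N -> e (u t) (u t.+1)].

Definition pos_edge {R : realType} {n} (A : 'M[R]_n) : rel 'I_n :=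
  [rel x y | 0 < A x y].

Definition path_of {n} T (u : nat -> 'I_n) : path_space n T :=
  [ffun i : 'I_T.+1 => u i].

(** The clause on times up to [a] lets facts about the joined walk be read back on its first
    piece. *)
Lemma walk_cat {n} (e : rel 'I_n) a b x z y u v :
  walk e a x z u -> walk e b z y v ->
  exists w, walk e (a + b) x y w /\ forall t, (t <= a)%N -> w t = u t.
Proof.
move=> [u0 ua ue] [v0 vb ve].
pose w t := if (t <= a)%N then u t else v (t - a)%N.
have w1 t : (t <= a)%N -> w t = u t by rewrite /w => ->.
have w2 t : w (a + t)%N = v t.
  rewrite /w; case: leqP => [le|_]; last by rewrite addKn.
  have -> : t = 0%N by lia.
  by rewrite addn0 ua v0.
exists w; split => //; split; [by rewrite w1|by rewrite w2|].
move=> t tab; case: (ltnP t a) => [lt|le].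
  by rewrite !w1 ?(ltnW lt)//; exact: ue.
by rewrite -(subnKC le) -addnS !w2; apply: ve; lia.
Qed.

Lemma mulmx_gt0_ex {R : realType} {n} (A B : 'M[R]_n) x y :
  (forall i j, 0 <= A i j) -> (forall i j, 0 <= B i j) ->
  0 < (A *m B) x y -> exists z, 0 < A x z /\ 0 < B z y.
Proof.
move=> A0 B0; rewrite mxE => /lt0r_neq0.
have AB z : true -> 0 <= A x z * B z y by move=> _; rewrite mulr_ge0.
rewrite (psumr_neq0 _ AB) => /hasP[z _ /= h]; exists z.
by move: h; rewrite !lt0r A0 B0 !andbT mulf_eq0 negb_or => /andP[/andP[-> ->]].
Qed.

Lemma expmx_ge0 {R : realType} {n} (A : 'M[R]_n) T :
  (forall i j, 0 <= A i j) -> forall i j, 0 <= (A ^+ T) i j.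
Proof.
move=> A0; elim: T => [|T IH] i j; first by rewrite expr0 mxE ler0n.
rewrite exprS -[_ * _]/(_ *m _) mxE; apply: sumr_ge0 => k _.
by rewrite mulr_ge0.
Qed.

Lemma expmx_gt0_walk {R : realType} {n} (A : 'M[R]_n) T x y :
  (forall i j, 0 <= A i j) -> 0 < (A ^+ T) x y ->
  exists u, walk (pos_edge A) T x y u.
Proof.
move=> A0; elim: T y => [|T IH] y.
  rewrite expr0 mxE; case: eqP => [->|]; last by rewrite ltxx.
  by move=> _; exists (fun=> y).
rewrite exprSr -[_ * _]/(_ *m _) => /mulmx_gt0_ex.
case=> //; first exact: expmx_ge0.
move=> z [/IH[u [u0 uT ue]] Azy].
exists (fun t => if (t <= T)%N then u t else y); split => //.
  by rewrite ltnn.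
move=> t; rewrite ltnS => tT; rewrite tT.
case: ltnP => tT' ; first exact: ue.
by have -> : t = T; [lia|rewrite uT].
Qed.

(** Positivity of [A ^+ N] gives every row of [A] a positive entry, so left multiplication by [A]
    keeps all entries positive. *)
Lemma expmx_gt0_ge {R : realType} {n} (A : 'M[R]_n) (N T : nat) :
  (0 < N)%N -> (forall i j, 0 <= A i j) -> (forall i j, 0 < (A ^+ N) i j) ->
  (N <= T)%N -> forall i j, 0 < (A ^+ T) i j.
Proof.
move=> N0 A0 AN /subnK <-; elim: (T - N)%N => [//|k IH] i j.
have [z [Aiz _]] : exists z, 0 < A i z /\ 0 < (A ^+ N.-1) z j.
  apply: mulmx_gt0_ex => //; first exact: expmx_ge0.
  by rewrite -[_ *m _]/(_ * _) -exprS prednK.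
rewrite addSn exprS -[_ * _]/(_ *m _) mxE (bigD1 z) //=.
by rewrite ltr_pwDl ?mulr_gt0// sumr_ge0// => l _; rewrite mulr_ge0// ltW.
Qed.

(** * First variation of relative entropy *)

(* Convexity of [p * ln (p / q)], with the tangent taken at [p1] so that [p = 0]
   is allowed. *)
Lemma tangent_ineq {R : realType} (p p1 q : R) :
  0 <= p -> 0 <= p1 -> (p != 0 -> p1 != 0) -> (p1 != 0 -> 0 < q) ->
  p1 * ln (p1 / q) - p * ln (p / q) <= (p1 - p) * ln (p1 / q) + (p1 - p).
Proof.
move=> p0 p10 pp1 p1q.
have [->|pn0] := eqVneq p 0; first by rewrite mul0r !subr0 lerDl.
have q0 := p1q (pp1 pn0).
have pp : 0 < p by rewrite lt0r pn0.
have pp1' : 0 < p1 by rewrite lt0r pp1.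
have h : ln (p1 / p) <= p1 / p - 1.
  have := @le_ln1Dx R (p1 / p - 1); rewrite (addrC 1) subrK; apply.
  by rewrite ltrBrDl subrr divr_gt0.
have : p * ln (p1 / p) <= p1 - p.
  rewrite -(ler_pM2l pp) in h; apply: (le_trans h).
  by rewrite mulrBr mulr1 mulrCA divff// mulr1.
rewrite !ln_div ?posrE//; nra.
Qed.

Lemma rel_entropy_fin {R : realType} {T : finType} (P Q : T -> R) :
  (forall x, P x != 0 -> Q x != 0) ->
  rel_entropy P Q = (\sum_x P x * ln (P x / Q x))%:E.
Proof.
move=> PQ; rewrite /rel_entropy ifT; last by apply/forallP => x; apply/implyP/PQ.
congr (_%:E); rewrite [RHS](bigID (fun x => P x != 0)) /=.
rewrite [X in _ = _ + X]big1 ?addr0// => x; rewrite negbK => /eqP ->.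
by rewrite mul0r.
Qed.

(** Sum of the tangent inequalities; the terms [P1 x - P x] cancel because both masses are 1. *)
Lemma rel_entropy_variation {R : realType} {T : finType} (P P1 Q : T -> R) :
  is_prob P -> is_prob P1 -> (forall x, 0 <= Q x) ->
  (forall x, P x != 0 -> P1 x != 0) -> (forall x, P1 x != 0 -> Q x != 0) ->
  (rel_entropy P Q <= rel_entropy P1 Q)%E ->
  0 <= \sum_x (P1 x - P x) * ln (P1 x / Q x).
Proof.
move=> [P0 sP] [P10 sP1] Q0 PP1 P1Q.
rewrite !rel_entropy_fin//; last by move=> x /PP1 /P1Q.
rewrite lee_fin -subr_ge0 -sumrB => h; apply: (le_trans h).
rewrite -[X in _ <= X]addr0 -[X in _ <= _ + X](subrr 1) -{1}sP1 -sP -sumrB -big_split /=.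
apply: ler_sum => x _; apply: tangent_ineq => //; first exact: PP1.
by move=> /P1Q; rewrite lt0r => ->; exact: Q0.
Qed.

(** The limit as [e] decreases to 0, replaced by one explicit [e]: for [e <= 1] the last two terms
    are at most [e * K <= - f0 / 2]. *)
Lemma quadratic_ge0_at0 {R : realType} (f0 f1 f2 e0 : R) : 0 < e0 ->
  (forall e, 0 < e -> e <= e0 -> 0 <= f0 + e * f1 + e ^+ 2 * f2) -> 0 <= f0.
Proof.
move=> e00 h; rewrite leNgt; apply/negP => f00.
pose K := `|f1| + `|f2| + 1.
have K0 : 0 < K by rewrite /K ltr_wpDl// addr_ge0.
pose e := Num.min (Num.min e0 1) (- f0 / (2 * K)).
have ee0 : e <= e0 by rewrite /e !ge_min lexx.
have e1 : e <= 1 by rewrite /e !ge_min lexx orbT.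
have eK : e <= - f0 / (2 * K) by rewrite /e ge_min lexx orbT.
have ep : 0 < e by rewrite /e !lt_min e00 ltr01 divr_gt0 ?oppr_gt0// mulr_gt0.
have := h e ep ee0.
rewrite ler_pdivlMr ?mulr_gt0// in eK.
have a1 := ler_norm f1; have a2 := ler_norm f2.
have b : e * f1 <= e * `|f1| by rewrite ler_wpM2l// ltW.
have c : e ^+ 2 * f2 <= e * `|f2|.
  rewrite expr2 -mulrA ler_wpM2l ?(ltW ep)//.
  apply: (@le_trans _ _ (e * `|f2|)); first by rewrite ler_wpM2l// ltW.
  by rewrite ler_piMl.
rewrite /K in eK; nra.
Qed.

(** * Paths given by sequences *)

Lemma path_ofE {n} T (u : nat -> 'I_n) t : (t <= T)%N ->
  path_of T u (inord t) = u t.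
Proof. by move=> tT; rewrite ffunE inordK. Qed.

Lemma path_of0 {n} T (u : nat -> 'I_n) : path_of T u ord0 = u 0%N.
Proof. by rewrite ffunE. Qed.

Lemma path_of_max {n} T (u : nat -> 'I_n) : path_of T u ord_max = u T.
Proof. by rewrite ffunE. Qed.

Lemma prod_path_of {R : realType} {n} T (u : nat -> 'I_n)
    (f : 'I_n -> 'I_n -> R) :
  \prod_(t < T) f (path_of T u (inord t)) (path_of T u (inord t.+1)) =
  \prod_(t < T) f (u t) (u t.+1).
Proof.
by apply: eq_bigr => t _; rewrite !path_ofE// ltnW// ltn_ord.
Qed.

(** * Exchange of end points and absolute continuity of the bridge *)

Lemma sum_delta {R : realType} {T : finType} (w : T) (f : T -> R) (A : pred T) :
  \sum_(x | A x) (x == w)%:R * f x = (A w)%:R * f w.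
Proof.
rewrite big_mkcond (bigD1 w) //= eqxx big1 ?addr0.
  by case: (A w); rewrite ?mul1r ?mul0r.
by move=> x /negPf ->; rewrite mul0r; case: (A x).
Qed.

(** Perturbation direction: mass goes to [w1], [w2] and leaves [w3], [w4]. Adding indicators makes
    coincidences among the four paths harmless. *)
Definition swap {R : realType} {T : finType} (w1 w2 w3 w4 : T) (x : T) : R :=
  (x == w1)%:R + (x == w2)%:R - (x == w3)%:R - (x == w4)%:R.

Lemma sum_swap {R : realType} {T : finType} (w1 w2 w3 w4 : T) (f : T -> R)
    (A : pred T) :
  \sum_(x | A x) swap w1 w2 w3 w4 x * f x =
  (A w1)%:R * f w1 + (A w2)%:R * f w2 - (A w3)%:R * f w3 - (A w4)%:R * f w4.
Proof.
rewrite -!sum_delta -big_split/= -!sumrB; apply: eq_bigr => x _.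
by rewrite /swap; ring.
Qed.

(* First variation along [swap w1 w2 w3 w4]: the tangent inequality at the
   perturbed measure [P + e h], which charges all four paths, gives the
   inequality up to terms of order [e] without knowing [P w1], [P w2] > 0. *)
Lemma bridge_swap_le {R : realType} {n T} (Q : path_space n T -> R)
    (nu0 nuT : 'I_n -> R) (P : path_space n T -> R) (w1 w2 w3 w4 : path_space n T) :
  (forall w, 0 <= Q w) -> (forall w, P w != 0 -> Q w != 0) ->
  is_schroedinger_bridge Q nu0 nuT P ->
  w1 ord0 = w3 ord0 -> w2 ord0 = w4 ord0 ->
  w1 ord_max = w4 ord_max -> w2 ord_max = w3 ord_max ->
  0 < Q w1 -> 0 < Q w2 ->
  P w3 * P w4 * (Q w1 * Q w2) <= P w1 * P w2 * (Q w3 * Q w4).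
Proof.
move=> Q0 PQ [pP m0 mT minP] e13 e24 e14 e23 q1 q2.
have [P0 sP] := pP.
have [->|p3] := eqVneq (P w3) 0; first by rewrite !mul0r !mulr_ge0.
have [->|p4] := eqVneq (P w4) 0; first by rewrite mulr0 !mul0r !mulr_ge0.
have q3 : 0 < Q w3 by rewrite lt0r PQ ?Q0.
have q4 : 0 < Q w4 by rewrite lt0r PQ ?Q0.
have {}p3 : 0 < P w3 by rewrite lt0r p3 P0.
have {}p4 : 0 < P w4 by rewrite lt0r p4 P0.
pose h := @swap R _ w1 w2 w3 w4.
(* Since [h >= -2], a step [e <= e0] removes at most half of the mass of [w3] or [w4]. *)
pose e0 := Num.min (P w3) (P w4) / 4.
have e00 : 0 < e0 by rewrite divr_gt0// lt_min p3.
rewrite -subr_ge0.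
(* [f1] and [f2] are the coefficients of [e] and [e ^+ 2] in the exchange inequality written for
   [P + e h]. *)
set f1 := (P w1 * h w2 + h w1 * P w2) * (Q w3 * Q w4)
          - (P w3 * h w4 + h w3 * P w4) * (Q w1 * Q w2).
set f2 := h w1 * h w2 * (Q w3 * Q w4) - h w3 * h w4 * (Q w1 * Q w2).
apply: (@quadratic_ge0_at0 R _ f1 f2 e0 e00) => e ep ee0.
have [e3 e4] : e * 4 <= P w3 /\ e * 4 <= P w4.
  by move: ee0; rewrite ler_pdivlMr// le_min => /andP[].
pose P1 w := P w + e * h w.
have hge w : -2 <= h w.
  rewrite /h /swap; by do 4!case: eqP => _ /=; lra.
have hnneg w : w != w3 -> w != w4 -> 0 <= h w.
  by move=> /negPf a /negPf b; rewrite /h /swap a b !subr0 addr_ge0.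
have P1pos w : (0 < P w) || (w == w1) || (w == w2) -> 0 < P1 w.
  have [->|n3] := eqVneq w w3; first by move=> _; have := hge w3; rewrite /P1; nra.
  have [->|n4] := eqVneq w w4; first by move=> _; have := hge w4; rewrite /P1; nra.
  case/orP => [/orP[pw|/eqP ww]|/eqP ww].
  - by rewrite /P1 ltr_pwDl// mulr_ge0 ?hnneg// ltW.
  - rewrite /P1 ltr_wpDl// mulr_gt0// /h /swap (negPf n3) (negPf n4) !subr0.
    by rewrite ww eqxx ltr_pwDl.
  - rewrite /P1 ltr_wpDl// mulr_gt0// /h /swap (negPf n3) (negPf n4) !subr0.
    by rewrite ww eqxx ltr_wpDl.
have P1ge w : 0 <= P1 w.
  have [/P1pos/ltW//|] := boolP ((0 < P w) || (w == w1) || (w == w2)).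
  rewrite !negb_or lt0r P0 andbT negbK => /andP[/andP[/eqP pw n1] n2].
  have n3 : w != w3 by apply: contraTneq p3 => <-; rewrite pw ltxx.
  have n4 : w != w4 by apply: contraTneq p4 => <-; rewrite pw ltxx.
  by rewrite /P1 pw add0r mulr_ge0 ?hnneg// ltW.
have PP1 w : P w != 0 -> P1 w != 0.
  by move=> pw; rewrite gt_eqF// P1pos// lt0r pw P0.
have P1Q w : P1 w != 0 -> Q w != 0.
  have [->|n1] := eqVneq w w1; first by rewrite (gt_eqF q1).
  have [->|n2] := eqVneq w w2; first by rewrite (gt_eqF q2).
  have [->|n3] := eqVneq w w3; first by rewrite (gt_eqF q3).
  have [->|n4] := eqVneq w w4; first by rewrite (gt_eqF q4).
  move=> pw; apply: PQ; move: pw; rewrite /P1 /h /swap.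
  by rewrite (negPf n1) (negPf n2) (negPf n3) (negPf n4) !subr0 addr0 mulr0 addr0.
(* One balance condition covers the total mass and both end marginals. *)
have sumP1 (A : pred (path_space n T)) :
    (A w1 + A w2 = A w3 + A w4)%N -> \sum_(w | A w) P1 w = \sum_(w | A w) P w.
  move=> AA; rewrite big_split/= -mulr_sumr.
  have -> : \sum_(w | A w) h w = \sum_(w | A w) h w * 1.
    by apply: eq_bigr => w _; rewrite mulr1.
  rewrite sum_swap !mulr1 -natrD AA natrD.
  by rewrite [X in e * X](_ : _ = 0) ?mulr0 ?addr0//; ring.
have pP1 : is_prob P1 by split => //; rewrite sumP1.
have M0 : marginal P1 ord0 =1 nu0.
  by move=> x; rewrite -m0 /marginal sumP1// e13 e24.
have MT : marginal P1 ord_max =1 nuT.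
  by move=> x; rewrite -mT /marginal sumP1// e14 e23 addnC.
have := rel_entropy_variation _ _ _ pP pP1 Q0 PP1 P1Q (minP P1 pP1 M0 MT).
have -> : \sum_w (P1 w - P w) * ln (P1 w / Q w) =
    e * \sum_w h w * ln (P1 w / Q w).
  by rewrite mulr_sumr; apply: eq_bigr => w _; rewrite /P1 addrC addKr mulrA.
rewrite pmulr_rge0// sum_swap !mul1r.
have P11 : 0 < P1 w1 by rewrite P1pos// eqxx orbT.
have P12 : 0 < P1 w2 by rewrite P1pos// eqxx orbT.
have P13 : 0 < P1 w3 by rewrite P1pos// p3.
have P14 : 0 < P1 w4 by rewrite P1pos// p4.
rewrite -addrA -opprD subr_ge0 -!lnM ?posrE ?divr_gt0//.
rewrite ler_ln ?posrE ?mulr_gt0 ?invr_gt0// !mulf_div.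
rewrite ler_pdivrMr ?mulr_gt0// mulrAC ler_pdivlMr ?mulr_gt0// -subr_ge0.
by congr (0 <= _); rewrite /P1 /f1 /f2; ring.
Qed.

(* Only the existence of a competitor of finite entropy matters: mix one
   [Q]-charged path for each pair of end points with weights [nu0 x * nuT y]. *)
Lemma bridge_abs_cont {R : realType} {n T} (Q : path_space n T -> R)
    (nu0 nuT : 'I_n -> R) (P : path_space n T -> R) :
  is_prob nu0 -> is_prob nuT ->
  (forall x y, exists w : path_space n T, [/\ w ord0 = x, w ord_max = y & Q w != 0]) ->
  is_schroedinger_bridge Q nu0 nuT P ->
  forall w, P w != 0 -> Q w != 0.
Proof.
move=> [n0 s0] [nT sT] exw [_ _ _ minP].
have [W HW] : {W : 'I_n * 'I_n -> path_space n T & forall xy,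
    [/\ W xy ord0 = xy.1, W xy ord_max = xy.2 & Q (W xy) != 0]}.
  apply: (@choice _ _ (fun xy (w : path_space n T) =>
    [/\ w ord0 = xy.1, w ord_max = xy.2 & Q w != 0])) => -[x y].
  exact: exw.
pose P' w := \sum_x \sum_y (w == W (x, y))%:R * (nu0 x * nuT y).
have sumP' (A : pred (path_space n T)) : \sum_(w | A w) P' w =
    \sum_x \sum_y (A (W (x, y)))%:R * (nu0 x * nuT y).
  rewrite exchange_big/=; apply: eq_bigr => x _.
  rewrite exchange_big/=; apply: eq_bigr => y _.
  exact: (sum_delta (W (x, y)) (fun=> nu0 x * nuT y)).
have pP' : is_prob P'.
  split.
    by move=> w; rewrite !sumr_ge0// => x _; rewrite sumr_ge0// => y _; rewrite !mulr_ge0.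
  rewrite (sumP' predT) -[RHS]s0; apply: eq_bigr => x _.
  by under eq_bigr do rewrite mul1r; rewrite -mulr_sumr sT mulr1.
have m0 : marginal P' ord0 =1 nu0.
  move=> x; rewrite /marginal (sumP' (fun w => w ord0 == x)) (bigD1 x)//=.
  rewrite [X in _ + X]big1 ?addr0.
    under eq_bigr => y _ do (have [-> _ _] := HW (x, y)).
    by under eq_bigr do rewrite eqxx mul1r; rewrite -mulr_sumr sT mulr1.
  move=> z /negPf zx; rewrite big1// => y _.
  by have [-> _ _] := HW (z, y); rewrite zx mul0r.
have mT : marginal P' ord_max =1 nuT.
  move=> y; rewrite /marginal (sumP' (fun w => w ord_max == y)) exchange_big (bigD1 y)//=.
  rewrite [X in _ + X]big1 ?addr0.
    under eq_bigr => x _ do (have [_ -> _] := HW (x, y)).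
    by under eq_bigr do rewrite eqxx mul1r; rewrite -mulr_suml s0 mul1r.
  move=> z /negPf zx; rewrite big1// => x _.
  by have [_ -> _] := HW (x, z); rewrite zx mul0r.
have P'Q w : P' w != 0 -> Q w != 0.
  apply: contraNN => /eqP qw; rewrite /P' big1// => x _; rewrite big1// => y _.
  case: eqP => [ww|_]; last by rewrite mul0r.
  by have [_ _] := HW (x, y); rewrite -ww qw eqxx.
have := minP P' pP' m0 mT; rewrite (rel_entropy_fin _ _ P'Q) /rel_entropy.
case: ifP => [/forallP h _ w|_]; first exact/implyP.
by rewrite leye_eq.
Qed.

(** * Coboundaries along walks *)

(* [r] is a coboundary up to a constant as soon as its products along walks of
   one fixed length satisfy the exchange rule for end points. *)
Lemma walk_gauge {R : realFieldType} {n} (e : rel 'I_n) (r : 'I_n -> 'I_n -> R)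
    T (a b : 'I_n) :
  e a b -> (forall x y, e x y -> 0 < r x y) ->
  (forall x y, exists u, walk e T x y u) ->
  (forall x y, exists u, walk e T.+1 x y u) ->
  (forall x y x' y' u1 u2 u3 u4,
     walk e T.+1 x y u1 -> walk e T.+1 x' y' u2 ->
     walk e T.+1 x y' u3 -> walk e T.+1 x' y u4 ->
     (\prod_(t < T.+1) r (u1 t) (u1 t.+1)) * (\prod_(t < T.+1) r (u2 t) (u2 t.+1)) =
     (\prod_(t < T.+1) r (u3 t) (u3 t.+1)) * (\prod_(t < T.+1) r (u4 t) (u4 t.+1))) ->
  exists k (h : 'I_n -> R), (forall x, 0 < h x) /\
    forall x y, e x y -> r x y = k * h y / h x.
Proof.
move=> eab r0 exT exT1 cross.
have [V HV] : {V : 'I_n * 'I_n -> nat -> 'I_n &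
    forall xy, walk e T.+1 xy.1 xy.2 (V xy)}.
  by apply: (choice (P := fun xy => walk e T.+1 xy.1 xy.2)) => -[x y]; exact: exT1.
pose prodr (u : nat -> 'I_n) : R := \prod_(t < T.+1) r (u t) (u t.+1).
have prod0 x y u : walk e T.+1 x y u -> 0 < prodr u.
  by move=> [_ _ ue]; apply: prodr_gt0 => t _; apply/r0/ue.
pose al x := prodr (V (x, a)); pose be y := prodr (V (a, y)).
have al0 x : 0 < al x by apply: prod0 (HV _).
have be0 x : 0 < be x by apply: prod0 (HV _).
(* Exchanging end points with a closed walk at [a] separates the dependence on [x] from that on
   [y]. *)
have fact x y u : walk e T.+1 x y u -> prodr u * prodr (V (a, a)) = al x * be y.
  by move=> uw; apply: (cross _ _ _ _ _ _ _ _ uw (HV (a, a)) (HV (x, a)) (HV (a, y))).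
(* Solved from [al x * be a * r a b = r x y * (al y * be b)], established below. *)
exists (r a b * be a / be b), (fun x => (al x)^-1); split.
  by move=> x; rewrite invr_gt0.
move=> x y exy; have [v [v0 vT ve]] := exT y a.
(* A walk of length [T.+2] with first edge from [x] to [y] and last edge from [a] to [b]; dropping
   either edge leaves a walk of length [T.+1]. *)
pose w t := if t is s.+1 then (if (s <= T)%N then v s else b) else x.
have we t : (t < T.+2)%N -> e (w t) (w t.+1).
  case: t => [|t] tT; first by rewrite /w v0.
  have tT1 : (t <= T)%N by [].
  rewrite /= tT1; have [tT'|tT'] := ltnP t T; first exact: ve.
  by have -> : t = T; [lia|rewrite vT].
have w1 : w 1%N = y by rewrite /w v0.
have wT1 : w T.+1 = a by rewrite /= leqnn.
have wT2 : w T.+2 = b by rewrite /= ltnn.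
have f1 : walk e T.+1 x a w by split => // t tT; apply: we; lia.
have f2 : walk e T.+1 y b (fun t => w t.+1) by split => // t tT; apply: we; lia.
have : prodr w * r a b = r x y * prodr (fun t => w t.+1).
  transitivity (\prod_(t < T.+2) r (w t) (w t.+1)).
    by rewrite big_ord_recr /= -/(w T.+1) -/(w T.+2) wT1 wT2.
  by rewrite big_ord_recl /= v0.
have F1 := fact _ _ _ f1; have F2 := fact _ _ _ f2.
have c0 : 0 < prodr (V (a, a)) by apply: prod0 (HV _).
move=> eq.
have {}eq : al x * be a * r a b = r x y * (al y * be b).
  by rewrite -F1 -F2 mulrAC eq mulrA.
have := al0 x; have := al0 y; have := be0 a; have := be0 b.
move=> /lt0r_neq0 b0 _ /lt0r_neq0 y0 /lt0r_neq0 x0.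
rewrite invrK.
apply: (mulIf (mulf_neq0 y0 b0)); rewrite -eq; field.
by rewrite b0 y0.
Qed.

(** * Uniqueness of positive eigenvectors and eigenvectors of powers *)

Lemma perron_unique {R : realFieldType} {n} (A : 'M[R]_n) (c : R) (u v : 'cV[R]_n) :
  (forall x y, 0 < A x y) -> (forall x, 0 < u x 0) ->
  A *m u = c *: u -> A *m v = c *: v -> exists k, v = k *: u.
Proof.
case: n A u v => [|n] A u v A0 u0 Au Av.
  by exists 0; apply/colP => -[].
(* Subtract the largest multiple of [u] lying below [v]. *)
pose i := [arg min_(i < ord0) (v i 0 / u i 0)]%O.
pose k := v i 0 / u i 0.
have kmin j : k * u j 0 <= v j 0.
  rewrite -ler_pdivlMr// /k /i; case: arg_minP => // l _; exact.
exists k; apply/eqP; rewrite -subr_eq0; apply/eqP.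
set d := v - k *: u.
have Ad : A *m d = c *: d.
  by rewrite mulmxBr Av -scalemxAr Au scalerA mulrC -scalerA -scalerBr.
have di : d i 0 = 0 by rewrite !mxE /k divfK ?subrr// gt_eqF.
have d0 j : 0 <= d j 0 by rewrite !mxE subr_ge0.
(* At the contact index [i], a sum of nonnegative [d j 0] with positive weights is 0, so [d]
   vanishes. *)
have : (A *m d) i 0 = 0 by rewrite Ad mxE di mulr0.
rewrite mxE => /eqP; rewrite psumr_eq0 => [/allP h|j _]; last by rewrite mulr_ge0// ltW.
apply/colP => j; have := h j (mem_index_enum _).
by rewrite /= mulf_eq0 gt_eqF//= => /eqP ->; rewrite mxE.
Qed.

Lemma expmx_eigen {R : comPzRingType} {n} (A : 'M[R]_n) (c : R) (u : 'cV[R]_n) T :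
  A *m u = c *: u -> (A ^+ T) *m u = c ^+ T *: u.
Proof.
move=> Au; elim: T => [|T IH]; first by rewrite !expr0 mul1mx scale1r.
by rewrite exprSr -[_ * _]/(_ *m _) -mulmxA Au -scalemxAr IH scalerA -exprS.
Qed.

Lemma expmx_eigen_row {R : comPzRingType} {n} (A : 'M[R]_n) (c : R) (u : 'rV[R]_n) T :
  u *m A = c *: u -> u *m (A ^+ T) = c ^+ T *: u.
Proof.
move=> Au; elim: T => [|T IH]; first by rewrite !expr0 mulmx1 scale1r.
by rewrite exprS -[_ * _]/(_ *m _) mulmxA Au -scalemxAl IH scalerA -exprS.
Qed.

(** * Homogeneous Markov measures on paths *)

Lemma marginal_last {R : realType} {n T} (nu : 'I_n -> R) (Pi : 'M[R]_n)
    (P : path_space n T -> R) y :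
  homogeneous_markov nu Pi P ->
  marginal P ord_max y = ((\row_x nu x) *m Pi ^+ T) 0 y.
Proof.
move=> hP; rewrite /marginal; under eq_bigr do rewrite hP; clear P hP.
elim: T y => [|T IH] y.
  rewrite expr0 mulmx1 mxE (bigD1 [ffun=> y])/=; last by rewrite ffunE.
  rewrite big_ord0 mulr1 ffunE big1 ?addr0//.
  move=> w /andP[/eqP wy /eqP []]; apply/ffunP => i; rewrite ffunE -wy.
  by congr (w _); rewrite !ord1.
rewrite exprSr -[Pi ^+ T * Pi]/(_ *m _) mulmxA mxE.
under [RHS]eq_bigr => z _ do rewrite -IH big_distrl.
rewrite /= pair_big_dep /=.
(* Appending [y] and forgetting the last point are inverse bijections between paths of length [T]
   and paths of length [T.+1] ending at [y]. *)
pose ext (w : path_space n T) : path_space n T.+1 :=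
  path_of T.+1 (fun t => if (t <= T)%N then w (inord t) else y).
pose res (w : path_space n T.+1) : path_space n T := path_of T (fun t => w (inord t)).
rewrite (reindex (fun w : path_space n T => (w ord_max, w)) )/=; last first.
  exists (fun p => p.2) => [w _//|[z w] /=]; rewrite unfold_in/= => /eqP ->//.
rewrite (reindex ext); last first.
  exists res => w; rewrite unfold_in /= => wy; apply/ffunP => i; rewrite !ffunE.
    by rewrite inordK; [rewrite -ltnS ltn_ord inord_val|rewrite ltnS ltnW].
  case: leqP => iT; first by rewrite inordK// inord_val.
  by rewrite -(eqP wy); congr (w _); apply/val_inj => /=; have := ltn_ord i; lia.
apply: eq_big => [w|w _]; first by rewrite eqxx ffunE ltnn eqxx.
rewrite big_ord_recr /= -mulrA; congr (_ * (_ * _)).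
- by rewrite ffunE /=; congr (nu (w _)); apply/val_inj; rewrite /= inordK.
- apply: eq_bigr => t _; have tT := ltn_ord t.
  by rewrite !path_ofE /= ?tT ?(ltnW tT)// leqW// ltnW.
- rewrite !path_ofE// leqnn ltnn; congr (Pi (w _) y).
  by apply/val_inj; rewrite /= inordK.
Qed.

Lemma ref_measure_path_of {R : realType} {n} T (mu0 : 'I_n -> R) (M : 'M[R]_n) u :
  ref_measure mu0 M (path_of T u) = mu0 (u 0%N) * \prod_(t < T) M (u t) (u t.+1).
Proof. by rewrite /ref_measure path_of0 (prod_path_of T u M). Qed.

Lemma homogeneous_markov_path_of {R : realType} {n T} (nu : 'I_n -> R)
    (Pi : 'M[R]_n) (P : path_space n T -> R) u :
  homogeneous_markov nu Pi P ->
  P (path_of T u) = nu (u 0%N) * \prod_(t < T) Pi (u t) (u t.+1).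
Proof. by move=> ->; rewrite path_of0 (prod_path_of T u Pi). Qed.

Lemma prod_neq0P {R : realType} T (F : nat -> R) :
  \prod_(t < T) F t != 0 -> forall t, (t < T)%N -> F t != 0.
Proof. by move=> /prodf_neq0 h t tT; exact: (h (Ordinal tT)). Qed.

Lemma is_prob_ex {R : realType} {T : finType} (P : T -> R) :
  is_prob P -> exists x, 0 < P x.
Proof.
move=> [P0 P1]; have := oner_neq0 R; rewrite -P1 psumr_neq0//.
by move=> /hasP[x _ /= Px]; exists x.
Qed.

(** Iterates a choice of a positive entry in each row; this serves to prolong a single edge to a
    full path. *)
Lemma stochastic_walk {R : realType} {n} (Pi : 'M[R]_n) T x :
  stochastic Pi -> exists y u, walk (pos_edge Pi) T x y u.
Proof.
move=> [Pi0 Pi1].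
have [f Hf] : {f : 'I_n -> 'I_n & forall x, 0 < Pi x (f x)}.
  apply: (choice (P := fun x y => 0 < Pi x y)) => z.
  by apply: is_prob_ex; split.
exists (iter T f x), (fun t => iter t f x); split => // t _.
by rewrite /pos_edge/= Hf.
Qed.

(** * Support and transition matrix of a homogeneous bridge *)

Section Bridge.
Context {R : realType} {n T N : nat} {M : 'M[R]_n} {mu0 nu : 'I_n -> R}.
Context {P : path_space n T -> R} {Pi : 'M[R]_n}.
Hypothesis TN : T = (N + N)%N.
Hypothesis N1 : (1 < N)%N.
Hypothesis M0 : forall x y, 0 <= M x y.
Hypothesis MN : forall x y, 0 < (M ^+ N) x y.
Hypothesis mu00 : forall x, 0 < mu0 x.
Hypothesis pnu : is_prob nu.
Hypothesis bP : is_schroedinger_bridge (ref_measure mu0 M) nu nu P.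
Hypothesis sPi : stochastic Pi.
Hypothesis hP : homogeneous_markov nu Pi P.
Local Notation Q := (@ref_measure R n T mu0 M).

Lemma exists_walk k x y : (N <= k)%N -> exists u, walk (pos_edge M) k x y u.
Proof.
move=> Nk; apply: expmx_gt0_walk => //.
by apply: (expmx_gt0_ge M N) => //; lia.
Qed.

Lemma ref_measure_ge0 (w : path_space n T) : 0 <= Q w.
Proof. by rewrite mulr_ge0 ?prodr_ge0// ltW. Qed.

Lemma ref_measure_walk x y u : walk (pos_edge M) T x y u -> 0 < Q (path_of T u).
Proof.
move=> [_ _ ue]; rewrite ref_measure_path_of mulr_gt0// prodr_gt0// => t _.
exact: ue.
Qed.

Lemma bridge_support w : P w != 0 -> Q w != 0.
Proof.
apply: (bridge_abs_cont _ _ _ _ pnu pnu _ bP) => x y.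
have [|u uw] := exists_walk T x y; first by rewrite TN leq_addr.
exists (path_of T u); rewrite path_of0 path_of_max gt_eqF ?(ref_measure_walk _ _ _ uw)//.
by case: uw.
Qed.

Lemma bridge_ge0 w : 0 <= P w. Proof. by case: bP => [[]]. Qed.

(** Take charged paths [w3] from [x] and [w4] to [y], and a walk [v] joining their other end points.
    If [P] vanished at [u], the exchange inequality would bound a positive number by 0. *)
Lemma bridge_pos x y u : 0 < nu x -> 0 < nu y -> walk (pos_edge M) T x y u ->
  0 < P (path_of T u).
Proof.
move=> nx ny uw.
case: (bP) => _ m0 mT _.
have [w3 [w3x w3P]] : exists w : path_space n T, w ord0 = x /\ P w != 0.
  have: marginal P ord0 x != 0 by rewrite m0 gt_eqF.
  rewrite /marginal psumr_neq0; last by move=> *; exact: bridge_ge0.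
  by move=> /hasP[w _ /andP[/eqP wx wP]]; exists w; rewrite gt_eqF.
have [w4 [w4y w4P]] : exists w : path_space n T, w ord_max = y /\ P w != 0.
  have: marginal P ord_max y != 0 by rewrite mT gt_eqF.
  rewrite /marginal psumr_neq0; last by move=> *; exact: bridge_ge0.
  by move=> /hasP[w _ /andP[/eqP wx wP]]; exists w; rewrite gt_eqF.
have [|v vw] := exists_walk T (w4 ord0) (w3 ord_max); first by rewrite TN leq_addr.
have := @bridge_swap_le R n T _ _ _ _ (path_of T u) (path_of T v) w3 w4
  ref_measure_ge0 bridge_support bP.
rewrite !path_of0 !path_of_max.
have q1 := ref_measure_walk _ _ _ uw; have q2 := ref_measure_walk _ _ _ vw.
case: uw => -> -> _; case: vw => -> -> _.
move=> /(_ (esym w3x) erefl (esym w4y) erefl q1 q2) h.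
rewrite lt0r bridge_ge0 andbT; apply/eqP => pu.
have p3 : 0 < P w3 by rewrite lt0r w3P bridge_ge0.
have p4 : 0 < P w4 by rewrite lt0r w4P bridge_ge0.
have : 0 < P w3 * P w4 * (Q (path_of T u) * Q (path_of T v)).
  by apply: mulr_gt0; apply: mulr_gt0.
by move/lt_le_trans => /(_ _ h); rewrite pu !mul0r ltxx.
Qed.

Lemma bridge_pos_edges u : 0 < P (path_of T u) ->
  forall t, (t < T)%N -> pos_edge Pi (u t) (u t.+1).
Proof.
move=> /lt0r_neq0; rewrite (homogeneous_markov_path_of _ _ _ _ hP).
rewrite mulf_eq0 negb_or => /andP[_ h] t tT.
rewrite /pos_edge /= lt0r (proj1 sPi) andbT.
exact: (prod_neq0P T (fun t => Pi (u t) (u t.+1)) h).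
Qed.

Lemma initial_pos x : 0 < nu x.
Proof.
have [x0 nx0] := is_prob_ex _ pnu.
(* A closed walk through [z] at time [N] is charged by [P], so its first half uses edges of [Pi]
   only. *)
have loop z : exists u, walk (pos_edge Pi) N x0 z u.
  have [u uw] := exists_walk N x0 z (leqnn N).
  have [v vw] := exists_walk N z x0 (leqnn N).
  have [w [ww wu]] := walk_cat _ _ _ _ _ _ _ _ uw vw.
  exists w; case: (uw) => u0 uN _; split; rewrite ?wu// => t tN.
  apply: bridge_pos_edges; last by rewrite TN; lia.
  by apply: (bridge_pos x0 x0) => //; rewrite TN.
(* By homogeneity the walk from [x0] to [x] can also be run during the second half, after a return
   to [x0]; the final marginal then charges [x]. *)
have [u uw] := loop x0; have [v vw] := loop x.
have [w [[w0 wT we] _]] := walk_cat _ _ _ _ _ _ _ _ uw vw.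
case: (bP) => _ _ mT _.
rewrite -mT /marginal (bigD1 (path_of T w)) /=; last first.
  by rewrite path_of_max TN wT.
rewrite ltr_pwDl//; last by apply: sumr_ge0 => *; exact: bridge_ge0.
rewrite (homogeneous_markov_path_of _ _ _ _ hP) w0 mulr_gt0// prodr_gt0// => t _.
by apply: we; rewrite -TN.
Qed.

(** The edge is made the first step of a path of length [T], any starting point being allowed by
    [initial_pos]. Edges of [Pi] are prolonged by stochasticity, edges of [M] by a walk of length
    [T.-1 >= N]. *)
Lemma pos_edgeE x y : pos_edge Pi x y = pos_edge M x y.
Proof.
have T2 : T = T.-1.+1 by rewrite TN; lia.
apply/idP/idP => xy.
  have [z [u [u0 _ ue]]] := stochastic_walk Pi T.-1 y sPi.
  pose w t := if t is s.+1 then u s else x.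
  have we t : (t < T)%N -> pos_edge Pi (w t) (w t.+1).
    case: t => [|t] tT /=; first by rewrite u0.
    by apply: ue; lia.
  have : P (path_of T w) != 0.
    rewrite (homogeneous_markov_path_of _ _ _ _ hP) mulf_neq0 ?gt_eqF ?initial_pos//.
    by apply: prodr_gt0 => t _; exact: we.
  move=> /bridge_support; rewrite ref_measure_path_of mulf_eq0 negb_or => /andP[_ h].
  rewrite /pos_edge /= lt0r M0 andbT.
  have := prod_neq0P T (fun t => M (w t) (w t.+1)) h 0%N.
  by rewrite /w u0; apply; rewrite T2.
have [|u [u0 uT ue]] := exists_walk T.-1 y y; first by rewrite TN; lia.
pose w t := if t is s.+1 then u s else x.
have ww : walk (pos_edge M) T x y w.
  split => //; first by rewrite T2.
  by case=> [|t] tT /=; [rewrite u0|apply: ue; lia].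
have := bridge_pos_edges w (bridge_pos x y w (initial_pos _) (initial_pos _) ww) 0%N.
by rewrite /w u0; apply; rewrite T2.
Qed.

(** Up to a factor of the initial point, the product of ratios is the density [P / Q], to which the
    exchange rule applies. *)
Lemma bridge_ratio_walk x y u : walk (pos_edge M) T x y u ->
  \prod_(t < T) (Pi (u t) (u t.+1) / M (u t) (u t.+1)) =
  P (path_of T u) * mu0 x / (nu x * Q (path_of T u)).
Proof.
move=> [u0 uT ue]; rewrite (homogeneous_markov_path_of _ _ _ _ hP) ref_measure_path_of u0.
rewrite prodf_div.
have M1 : \prod_(t < T) M (u t) (u t.+1) != 0.
  by apply/prodf_neq0 => t _; rewrite gt_eqF//; exact: ue.
by field; rewrite M1 !gt_eqF// initial_pos.
Qed.

(** All four paths are charged by [Q], so the exchange inequality holds both ways. The factors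
    [mu0 / nu] agree because both sides start from [x] and [x']. *)
Lemma bridge_cross x y x' y' u1 u2 u3 u4 :
  walk (pos_edge M) T x y u1 -> walk (pos_edge M) T x' y' u2 ->
  walk (pos_edge M) T x y' u3 -> walk (pos_edge M) T x' y u4 ->
  (\prod_(t < T) (Pi (u1 t) (u1 t.+1) / M (u1 t) (u1 t.+1))) *
  (\prod_(t < T) (Pi (u2 t) (u2 t.+1) / M (u2 t) (u2 t.+1))) =
  (\prod_(t < T) (Pi (u3 t) (u3 t.+1) / M (u3 t) (u3 t.+1))) *
  (\prod_(t < T) (Pi (u4 t) (u4 t.+1) / M (u4 t) (u4 t.+1))).
Proof.
move=> h1 h2 h3 h4.
rewrite (bridge_ratio_walk _ _ _ h1) (bridge_ratio_walk _ _ _ h2).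
rewrite (bridge_ratio_walk _ _ _ h3) (bridge_ratio_walk _ _ _ h4).
have q1 := ref_measure_walk _ _ _ h1; have q2 := ref_measure_walk _ _ _ h2.
have q3 := ref_measure_walk _ _ _ h3; have q4 := ref_measure_walk _ _ _ h4.
have n1 := initial_pos x; have n2 := initial_pos x'.
case: h1 => a1 b1 _; case: h2 => a2 b2 _; case: h3 => a3 b3 _; case: h4 => a4 b4 _.
have : P (path_of T u3) * P (path_of T u4) * (Q (path_of T u1) * Q (path_of T u2)) =
       P (path_of T u1) * P (path_of T u2) * (Q (path_of T u3) * Q (path_of T u4)).
  apply/eqP; rewrite eq_le; apply/andP; split;
    apply: (bridge_swap_le _ _ _ _ _ _ _ _ ref_measure_ge0 bridge_support bP) => //;
    rewrite ?path_of0 ?path_of_max; congruence.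
move: (P (path_of T u1)) (P (path_of T u2)) (P (path_of T u3)) (P (path_of T u4))
  q1 q2 q3 q4 => p1 p2 p3 p4.
move: (Q (path_of T u1)) (Q (path_of T u2)) (Q (path_of T u3)) (Q (path_of T u4))
  => r1 r2 r3 r4 q1 q2 q3 q4 e.
have -> : p1 * mu0 x / (nu x * r1) * (p2 * mu0 x' / (nu x' * r2)) =
  (mu0 x * mu0 x' / (nu x * nu x' * r1 * r2 * r3 * r4)) * (p1 * p2 * (r3 * r4)).
  by field; rewrite !gt_eqF.
by rewrite -e; field; rewrite !gt_eqF.
Qed.

Lemma bridge_transition : exists k (h : 'I_n -> R), (forall x, 0 < h x) /\
  forall x y, Pi x y = k * M x y * h y / h x.
Proof.
have [x0 _] := is_prob_ex _ pnu.
have [u [u0 uN ue]] := exists_walk N x0 x0 (leqnn N).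
have T2 : T = T.-1.+1 by rewrite TN; lia.
have [||||k [h [h0 hr]]] := @walk_gauge R n (pos_edge M) (fun x y => Pi x y / M x y) T.-1
  (u 0%N) (u 1%N) (ue 0%N (ltnW N1)).
- by move=> x y xy; rewrite divr_gt0//; move: xy; rewrite -pos_edgeE.
- by move=> x y; apply: exists_walk; rewrite TN; lia.
- by move=> x y; rewrite -T2; apply: exists_walk; rewrite TN; lia.
- by rewrite -T2; exact: bridge_cross.
exists k, h; split => // x y.
have [xy|xy] := boolP (pos_edge M x y).
  have Mxy : 0 < M x y := xy.
  rewrite -(divfK (lt0r_neq0 Mxy) (Pi x y)) (hr x y xy).
  by field; rewrite gt_eqF.
(* Off the edges the ratio carries no information, but [Pi] and [M] vanish together. *)
have := xy; rewrite /pos_edge /= lt0r M0 andbT negbK => /eqP ->.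
rewrite mulr0 !mul0r; move: xy; rewrite -pos_edgeE /pos_edge /= lt0r (proj1 sPi) andbT negbK.
by move/eqP.
Qed.

End Bridge.

(** * Identification of the transition matrix and of the marginal *)

Theorem theorem3p4 (R : realType) (n N : nat) (M : 'M[R]_n)
  (lambda : R) (phi phihat : 'rV[R]_n) (mu0 nu : 'I_n -> R)
  (P : path_space n (2 * N) -> R) (Pi : 'M[R]_n) :
  (1 < N)%N ->
  (forall x y, 0 <= M x y) ->
  (forall x y, 0 < (M ^+ N) x y) ->
  is_spectral_radius M lambda ->
  M *m phi^T = lambda *: phi^T ->
  phihat *m M = lambda *: phihat ->
  (forall x, 0 < phi 0 x) ->
  (forall x, 0 < phihat 0 x) ->
  \sum_x phi 0 x * phihat 0 x = 1 ->
  (forall x, 0 < mu0 x) ->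
  is_prob nu ->
  is_schroedinger_bridge (ref_measure mu0 M) nu nu P ->
  stochastic Pi ->
  homogeneous_markov nu Pi P ->
  (forall x, nu x = phi 0 x * phihat 0 x) /\
  Pi = lambda^-1 *: (invmx (diag_mx phi) *m M *m diag_mx phi).
Proof.
move=> N1 M0 MN _ Mphi Mhat phi0 hat0 nrm mu00 pnu bP sPi hP.
have TN : (2 * N = N + N)%N by lia.
have [k [h [h0 Pih]]] := bridge_transition TN N1 M0 MN mu00 pnu bP sPi hP.
pose hv : 'cV[R]_n := \col_x h x.
(* Unit row sums of [Pi] make [h] an eigenvector of [M]. *)
have kMh x : k * (M *m hv) x 0 = h x.
  have [_ /(_ x)] := sPi; under eq_bigr do rewrite Pih.
  rewrite -mulr_suml => /(canRL (divfK (lt0r_neq0 (h0 x)))); rewrite mul1r => <-.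
  by rewrite mxE mulr_sumr; apply: eq_bigr => y _; rewrite mxE mulrA.
have [x0 _] := is_prob_ex _ pnu.
have k0 : k != 0.
  by apply/eqP => k0; have := h0 x0; rewrite -kMh k0 mul0r ltxx.
have Mh : M *m hv = k^-1 *: hv.
  by apply/colP => x; rewrite [RHS]mxE [hv x 0]mxE -kMh mulrA mulVf// mul1r.
(* Evaluating [phihat *m M *m hv] on either side identifies the eigenvalue, the pairing
   [phihat *m hv] being positive. *)
have lk : lambda = k^-1.
  have e : lambda *: (phihat *m hv) = k^-1 *: (phihat *m hv).
    by rewrite scalemxAl -Mhat -mulmxA Mh scalemxAr.
  have p : 0 < (phihat *m hv) 0 0.
    rewrite mxE (bigD1 x0)//= ltr_pwDl//; first by rewrite mxE mulr_gt0.
    by apply: sumr_ge0 => y _; rewrite mxE ltW// mulr_gt0.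
  have := congr1 (fun A : 'M[R]_1 => A 0 0) e; rewrite mxE [RHS]mxE.
  exact: (mulIf (lt0r_neq0 p)).
(* Uniqueness is applied to [M ^+ N], since [M] itself may have zero entries. *)
have [c hc] : exists c, hv = c *: phi^T.
  apply: (perron_unique (M ^+ N) (lambda ^+ N)) => //.
  - by move=> x; rewrite mxE.
  - exact: expmx_eigen.
  - by apply: expmx_eigen; rewrite lk.
have hcE x : h x = c * phi 0 x.
  by have /colP/(_ x) := hc; rewrite !mxE.
have c0 : c != 0.
  by apply/eqP => c0; have := h0 x0; rewrite hcE c0 mul0r ltxx.
have PiE x y : phi 0 x * Pi x y = lambda^-1 * M x y * phi 0 y.
  by rewrite Pih lk invrK !hcE; field; rewrite c0 gt_eqF.
have D : diag_mx phi \in unitmx.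
  by rewrite unitmxE det_diag unitfE; apply/prodf_neq0 => i _; rewrite gt_eqF.
have comm1 : diag_mx phi *m Pi = lambda^-1 *: (M *m diag_mx phi).
  apply/matrixP => x y.
  by rewrite [RHS]mxE mul_diag_mx mul_mx_diag !mxE PiE mulrA.
split; last first.
  by rewrite -[LHS](mulKmx D) comm1 -scalemxAr mulmxA.
(* Conjugation by [diag_mx phi] turns invariance of [nu] under a power of [Pi] into a left
   eigenvector equation for the same power of [M]. *)
pose w : 'rV[R]_n := \row_x (nu x / phi 0 x).
have l0 : lambda != 0 by rewrite lk invr_eq0.
have comm T : diag_mx phi *m Pi ^+ T = (lambda^-1 ^+ T) *: (M ^+ T *m diag_mx phi).
  elim: T => [|T IH]; first by rewrite !expr0 mulmx1 mul1mx scale1r.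
  rewrite exprSr -[Pi ^+ T * Pi]/(_ *m _) mulmxA IH -scalemxAl -mulmxA comm1.
  by rewrite -scalemxAr scalerA mulmxA -exprSr (exprSr M).
have nuw : \row_x nu x = w *m diag_mx phi.
  by apply/rowP => x; rewrite mul_mx_diag !mxE divfK// gt_eqF.
(* The equal end marginals give invariance over the whole horizon only, hence the power [2 * N]. *)
have inv : (\row_x nu x) *m Pi ^+ (2 * N) = \row_x nu x.
  apply/rowP => x; rewrite -(marginal_last _ _ _ _ hP) [RHS]mxE.
  by case: bP.
have wM : w *m M ^+ (2 * N) = lambda ^+ (2 * N) *: w.
  apply: (can_inj (mulmxK D)); rewrite -scalemxAl -nuw -[in RHS]inv nuw.
  rewrite -[in RHS]mulmxA comm -scalemxAr scalerA mulmxA -exprMn mulfV// expr1n.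
  by rewrite scale1r.
(* Transposition brings left eigenvectors under the uniqueness result for columns. *)
have [d dE] : exists d, w^T = d *: phihat^T.
  apply: (perron_unique (M ^+ (2 * N))^T (lambda ^+ (2 * N))).
  - by move=> x y; rewrite mxE; apply: (expmx_gt0_ge M N) => //; lia.
  - by move=> x; rewrite mxE.
  - by rewrite -trmx_mul (expmx_eigen_row _ _ _ _ Mhat) linearZ.
  - by rewrite -trmx_mul wM linearZ.
have nuE x : nu x = d * (phi 0 x * phihat 0 x).
  have /colP/(_ x) := dE; rewrite !mxE => /(canRL (divfK (lt0r_neq0 (phi0 x)))) ->.
  by rewrite mulrAC mulrA.
have d1 : d = 1.
  have [_] := pnu; under eq_bigr do rewrite nuE.
  by rewrite -mulr_sumr nrm mulr1.
by move=> x; rewrite nuE d1 mul1r.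
Qed.
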